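(* Let $k=13$ and let $K$ be the finite point set defined in the context. Then $K$ is a counterexample to Borsuk's conjecture in dimension $1325$ and in all higher dimensions up to $1560$. That is, for every integer $n$ with $1325\le n\le 1560$, $K$ is isometric to a subset of $n$-dimensional Euclidean space, and it cannot be divided into $n+1$ parts each of diameter smaller than the diameter of $K$.
   Context: Construction of $K$ (with $k=13$): let $m=4k=52$, $V=\{1,2,\dots,m\}$, and let $W=\{\{a,b\}: a,b\in V,\ a\ne b\}$ be the set of 2-element subsets of $V$. Let $H=\{A\subset V: |A|=2k\}$. For $A\in H$ let $N(A)=V\setminus A$ and $S(A)=\{\{a,b\}: a\in A,\ b\in N(A)\}\subseteq W$. Let $K=\{S(A):A\in H\}$. Each subset $X\subseteq W$ is identified with its $\{0,1\}$-indicator vector in $\mathbb{R}^W$, so $K$ is a finite point set in $\mathbb{R}^W$ with Euclidean distance $\mathrm{dist}(X,Y)=\sqrt{|X\triangle Y|}$, where $\triangle$ is symmetric difference. The diameter of a subset of $K$ is the maximum of the distances between its points (and $0$ for the empty set). Borsuk's conjecture in dimension $n$: every bounded subset of $n$-dimensional Euclidean space containing at least two points can be divided into $n+1$ parts of smaller diameter than the whole set. *)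

(* Defs.v *)
From HB Require Import structures.
From mathcomp Require Import all_boot all_order all_algebra.
From mathcomp Require Import all_classical all_reals.

Set Implicit Arguments.
Unset Strict Implicit.
Unset Printing Implicit Defensive.

Import Order.TTheory GRing.Theory Num.Theory.

Local Open Scope ring_scope.

(* R^I for a finite index type I. Real matrices and row vectors carry the sup
   norm in MathComp-Analysis, hence the explicit Euclidean distance below. *)
Definition euclid (R : realType) (I : finType) : Type := {ffun I -> R}.

Definition edist (R : realType) (I : finType) (x y : euclid R I) : R :=
  Num.sqrt (\sum_(i : I) (x i - y i) ^+ 2).

Definition ebounded (R : realType) (I : finType) (X : set (euclid R I)) : Prop :=
  exists M : R, forall x y, X x -> X y -> edist x y <= M.

(* [sup] is the least upper bound for a nonempty bounded set of reals, and
   [sup set0 = 0]: so the empty set has diameter 0, and the diameter of a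
   nonempty finite set is a maximum (lemma [ediam_max]). *)
Definition ediam (R : realType) (I : finType) (X : set (euclid R I)) : R :=
  sup [set d | exists x y, [/\ X x, X y & d = edist x y]]%classic.

(* The parts may be empty and may overlap. Allowing overlaps does not matter:
   shrinking the parts to disjoint ones does not increase their diameters. *)
Definition divisible (R : realType) (I : finType) (p : nat)
    (X : set (euclid R I)) : Prop :=
  exists P : 'I_p -> set (euclid R I),
    X = (\bigcup_(j in setT) P j)%classic /\ forall j, ediam (P j) < ediam X.

Definition isometric (R : realType) (I J : finType)
    (X : set (euclid R I)) (Y : set (euclid R J)) : Prop :=
  exists f : euclid R I -> euclid R J,
    (f @` X)%classic = Y /\
    forall x y, X x -> X y -> edist (f x) (f y) = edist x y.

(* X need not be given inside R^n: it suffices that it is isometric to a subset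
   of R^n, since all the other conditions are invariant under isometry. *)
Definition borsuk_counterexample (R : realType) (I : finType) (n : nat)
    (X : set (euclid R I)) : Prop :=
  [/\ ebounded X,
      exists x y, [/\ X x, X y & x <> y],
      exists Y : set (euclid R 'I_n), isometric X Y
    & ~ divisible n.+1 X].

(* {0, ..., 4k-1} stands for {1, ..., 4k}. *)
Definition Vset (k : nat) : finType := 'I_(4 * k).

Definition Wset (k : nat) : finType := {e : {set Vset k} | #|e| == 2%N}.

Definition Hset (k : nat) : {set {set Vset k}} := [set A : {set Vset k} | #|A| == (2 * k)%N].

Definition Nset (k : nat) (A : {set Vset k}) : {set Vset k} := ~: A.

Definition Sset (k : nat) (A : {set Vset k}) : {set Wset k} :=
  [set e : Wset k | [exists a in A, exists b in Nset A, val e == [set a; b]]].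

Definition indicator (R : realType) (I : finType) (X : {set I}) : euclid R I :=
  [ffun i => (i \in X)%:R].

Definition Kset (R : realType) (k : nat) : set (euclid R (Wset k)) :=
  [set x | exists2 A, A \in Hset k & x = indicator R (Sset A)]%classic.

Arguments Kset : clear implicits.

Lemma edist_indicator (R : realType) (I : finType) (X Y : {set I}) :
  edist (indicator R X) (indicator R Y) =
  Num.sqrt (#|(X :\: Y) :|: (Y :\: X)|%:R).
Proof.
rewrite /edist -sum1_card natr_sum [in RHS]big_mkcond /=; congr Num.sqrt.
apply: eq_bigr => i _; rewrite !ffunE !inE.
by case: (i \in X); case: (i \in Y);
  rewrite /= ?subrr ?subr0 ?sub0r ?sqrrN ?expr0n ?expr1n.
Qed.

Lemma ediam_max (R : realType) (I : finType) (X : set (euclid R I)) :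
  finite_set X -> (X !=set0)%classic ->
  (exists x y, [/\ X x, X y & ediam X = edist x y]) /\
  forall x y, X x -> X y -> edist x y <= ediam X.
Proof.
move=> /finite_seqP[s Xs] [x0 Xx0].
pose l := [seq edist x y | x <- s, y <- s].
have inl x y : X x -> X y -> edist x y \in l.
  by rewrite Xs /= => xs ys; apply/allpairsP; exists (x, y).
have ll d : d \in l -> exists x y, [/\ X x, X y & d = edist x y].
  by move=> /allpairsP[[x y] /= [xs ys ->]]; exists x, y; rewrite Xs.
have [m ml mub] : exists2 m, m \in l & forall d, d \in l -> d <= m.
  have : l != [::] by apply/eqP => l0; have := inl _ _ Xx0 Xx0; rewrite l0.
  elim: (l) => // a [|b t] IH _.
    by exists a; rewrite ?inE // => d; rewrite inE => /eqP->.
  have [//|m ml mub] := IH; exists (Num.max a m).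
    by case: (leP a m); rewrite inE ?ml ?eqxx ?orbT.
  by move=> d; rewrite inE le_max => /orP[/eqP->|/mub->];
    rewrite ?lexx ?orbT.
have -> : ediam X = m.
  apply/eqP; rewrite eq_le; apply/andP; split.
    apply: ge_sup; first by exists (edist x0 x0); exists x0, x0.
    by move=> d [x [y [xX yX ->]]]; apply: mub; apply: inl.
  apply: ub_le_sup; last exact: ll.
  by exists m => d [x [y [xX yX ->]]]; apply: mub; apply: inl.
by split; [exact: ll | move=> x y xX yX; apply: mub; apply: inl].
Qed.

(* Main.v *)
Require Import Defs.
From mathcomp Require Import all_boot all_order all_algebra.
From mathcomp Require Import all_classical all_reals.
From mathcomp Require Import zify ring.

Set Implicit Arguments.
Unset Strict Implicit.
Unset Printing Implicit Defensive.

Import Order.TTheory GRing.Theory Num.Theory.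

Local Open Scope ring_scope.

(** Identify a set C of vertices with its side of a cut: S(C) is the set of
edges crossing from C to its complement. The map S is linear over F_2, so the
symmetric difference of S(A) and S(B) is the cut S(A symdiff B)
([Sset_symdiff]), and a cut has |C| |V - C| edges ([card_Sset]). For two
2k-subsets of a 4k-set meeting in x points this gives squared distance
4 x (2k - x) ([edist_Kset]), which by AM-GM is at most (2k)^2, with equality
when x = k. Hence a part of K of smaller diameter contains no S(A) and S(B)
with |A :&: B| = k.

As A and its complement have the same cut, points of K are represented by the
sets A through a fixed vertex v. Let k = p be prime. Among the 2p-sets through
v, a family F with no two members meeting in exactly p points has at most
C(4p-1, p-1) members ([card_avoiding_family]): consider, over F_p, the inclusion
matrix M of F against the (p-1)-sets D avoiding v. The entry of M M^T at (A, B)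
counts the D contained in both, so it is C(x-1, p-1) with x = |A :&: B|. This is
nonzero mod p for x = 2p and zero mod p for the other possible values of x,
namely 0 < x < 2p with x != p. So M M^T is a nonzero multiple of the identity,
and M has at least as many columns as rows.

There are C(4p-1, 2p-1) sets of size 2p through v, so a division of K into q
parts has C(4p-1, 2p-1) <= q C(4p-1, p-1) ([divisible_Kset]). For p = 13 this
fails when q <= 1561 ([bin_51]).

Finally, K lies in R^W with |W| = C(52, 2) = 1326, and all its points have
coordinate sum (2k)^2, since all the cuts have that size. So K lies in a
hyperplane and embeds isometrically in R^1325, hence in R^n for n >= 1325
([hyperplane_isometric]). *)

(** * Families of sets with a forbidden intersection size *)

(** Absorption: x C(x-1, p-1) = p C(x, p). *)
Lemma prime_dvd_bin_pred (p x : nat) :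
  prime p -> ~~ (p %| x)%N -> (p %| 'C(x.-1, p.-1))%N.
Proof.
move=> p_pr npx; rewrite -(Gauss_dvdr (m := p) (n := x)); last first.
  by rewrite prime_coprime.
by rewrite mul_bin_diag prednK ?prime_gt0 // dvdn_mulr.
Qed.

(** C(2p-1, p-1) (p-1)! is the product of the integers strictly between p
and 2p. *)
Lemma prime_ndvd_bin_double (p : nat) :
  prime p -> ~~ (p %| 'C((2 * p).-1, p.-1))%N.
Proof.
move=> p_pr; have p_gt0 := prime_gt0 p_pr.
apply/negP => /(dvdn_mulr (p.-1)`!); rewrite bin_ffact ffact_prod.
rewrite Euclid_dvd_prod // big_orE => /existsP[i] /dvdnP[c e].
by have := ltn_ord i; case: c e => [|[|c]]; nia.
Qed.

(** The Frankl-Wilson bound for a star. Requiring all members to contain v is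
what makes the bound a single binomial coefficient: the Gram matrix of the
inclusion matrix is scalar modulo p, without any polynomial argument. *)
Theorem card_avoiding_family (p : nat) (T : finType) (v : T)
    (F : {set {set T}}) :
  prime p ->
  (forall A, A \in F -> v \in A /\ #|A| = (2 * p)%N) ->
  (forall A B, A \in F -> B \in F -> #|A :&: B| != p) ->
  (#|F| <= 'C(#|T|.-1, p.-1))%N.
Proof.
move=> p_pr F_star F_avoid.
pose J : {set {set T}} := [set D : {set T} | D \subset ~: [set v] & #|D| == p.-1].
have -> : 'C(#|T|.-1, p.-1) = #|J| by rewrite cards_draws cardsC1.
pose M : 'M['F_p]_(#|F|, #|J|) :=
  \matrix_(i < #|F|, j < #|J|) ((enum_val j : {set T}) \subset enum_val i)%:R.
pose c : 'F_p := ('C((2 * p).-1, p.-1))%:R.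
have Fp0 m : (m%:R == 0 :> 'F_p) = (p %| m)%N by rewrite (dvdn_pcharf (pchar_Fp p_pr)).
have c_neq0 : c != 0 by rewrite Fp0 prime_ndvd_bin_double.
have gram A B : A \in F -> B \in F ->
    \sum_(D in J) (D \subset A)%:R * (D \subset B)%:R
      = ('C(#|A :&: B|.-1, p.-1))%:R :> 'F_p.
  move=> FA FB; have vAB : v \in A :&: B by rewrite inE (F_star _ FA).1 (F_star _ FB).1.
  have -> : #|A :&: B|.-1 = #|(A :&: B) :\ v| by rewrite (cardsD1 v (A :&: B)) vAB.
  rewrite -cards_draws -sum1_card natr_sum big_mkcond [RHS]big_mkcond /=.
  apply: eq_bigr => D _; rewrite !inE -natrM mulnb finset.setDE !finset.subsetI.
  by case: (D \subset A); case: (D \subset B); case: (D \subset _);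
    case: (#|D| == _).
have MMt : (c^-1 *: M) *m M^T = 1%:M.
  apply/matrixP => i j; rewrite -scalemxAl !mxE.
  have -> : \sum_j0 M i j0 * M^T j0 j
      = ('C(#|enum_val i :&: enum_val j|.-1, p.-1))%:R.
    rewrite -gram ?enum_valP // [RHS]big_enum_val /=.
    by apply: eq_bigr => l _; rewrite !mxE.
  have [<-|neq_ij] := eqVneq i j.
    by rewrite finset.setIid (F_star _ (enum_valP i)).2 mulVf.
  set x := #|_|; rewrite (_ : _%:R = 0) ?mulr0 //.
  apply/eqP; rewrite Fp0 prime_dvd_bin_pred //.
  have [Ai Aj] := (enum_valP i, enum_valP j).
  have x_neq : x != p := F_avoid _ _ Ai Aj.
  (* v lies in both sets, so x is positive. *)
  have x_gt0 : (0 < x)%N.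
    by apply/card_gt0P; exists v; rewrite inE (F_star _ Ai).1 (F_star _ Aj).1.
  have x_lt : (x < 2 * p)%N.
    rewrite ltnNge; apply/negP => x_ge; case/eqP: neq_ij; apply: enum_val_inj.
    have sub_eq (l : 'I_#|F|) : enum_val i :&: enum_val j \subset enum_val l ->
        enum_val i :&: enum_val j = enum_val l.
      by move=> sub; apply/eqP; rewrite eqEcard sub (F_star _ (enum_valP l)).2.
    by rewrite -(sub_eq i) ?finset.subsetIl // {1}(sub_eq j) ?finset.subsetIr.
  (* The only multiple of p strictly between 0 and 2p is p. *)
  by apply/negP=> /dvdnP[[|[|q]] xE]; move: x_neq x_gt0 x_lt; rewrite xE; nia.
exact: mulmx1_min MMt.
Qed.

(** * The cut map and distances in K *)

(** In this form S is visibly linear over F_2, which gives [Sset_symdiff]. *)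
Lemma mem_Sset (k : nat) (C : {set Vset k}) (e : Wset k) (a b : Vset k) :
  val e = [set a; b] -> (e \in Sset C) = (a \in C) (+) (b \in C).
Proof.
move=> eE; rewrite inE; apply/existsP/idP => [[a'] | ].
  case/andP=> Ca' /existsP[b' /andP[]]; rewrite /Nset inE => Cb'.
  rewrite eE => /eqP E.
  have neq : a' != b' by apply: contraNneq Cb' => <-.
  have := finset.set21 a' b'; have := finset.set22 a' b'.
  rewrite -E !inE; do 2![case/orP=> /eqP ?]; subst; rewrite ?eqxx // in neq *.
  - by rewrite Ca' (negPf Cb').
  - by rewrite Ca' (negPf Cb').
move=> ab; case Ca: (a \in C) ab => /= Cb.
  exists a; rewrite Ca; apply/existsP; exists b.
  by rewrite /Nset inE Cb eE eqxx.
exists b; rewrite Cb; apply/existsP; exists a.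
by rewrite /Nset inE Ca eE finset.setUC eqxx.
Qed.

Lemma Sset_symdiff (k : nat) (A B : {set Vset k}) :
  (Sset A :\: Sset B) :|: (Sset B :\: Sset A) = Sset ((A :\: B) :|: (B :\: A)).
Proof.
apply/setP => e; have /cards2P[a [b [_ eE]]] := valP e.
rewrite !(inE, mem_Sset _ eE).
by case: (a \in A); case: (b \in A); case: (a \in B); case: (b \in B).
Qed.

(** Orienting each edge of the cut from C to its complement makes the cut a
product. *)
Lemma card_Sset (k : nat) (C : {set Vset k}) : #|Sset C| = (#|C| * #|~: C|)%N.
Proof.
rewrite -cardsX -(card_imset _ val_inj).
pose f (q : Vset k * Vset k) : {set Vset k} := [set q.1; q.2].
rewrite -(card_in_imset (f := f) (D := finset.setX C (~: C))).
  congr (#|pred_of_set _|); apply/setP => s; apply/imsetP/imsetP => [[e eC ->]|].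
    have /cards2P[a [b [_ eE]]] := valP e; move: eC; rewrite (mem_Sset _ eE) eE.
    case Ca: (a \in C) => /= Cb.
      by exists (a, b); rewrite // !inE Ca.
    by exists (b, a); rewrite /f /= 1?finset.setUC // !inE Ca Cb.
  case=> -[a b]; rewrite !inE /f /= => /andP[Ca Cb] ->.
  have ab : #|[set a; b]| == 2%N.
    by rewrite cards2 (_ : a != b) //; apply: contraNneq Cb => <-.
  exists (Sub [set a; b] ab); rewrite ?SubK //.
  by rewrite (@mem_Sset _ _ _ a b) ?SubK // Ca.
move=> [a b] [a' b']; rewrite !inE /f /= => /andP[Ca Cb] /andP[Ca' Cb'] E.
have := finset.set21 a b; have := finset.set22 a b; rewrite E !inE.
case/orP=> /eqP ?; last first.
  by case/orP=> /eqP ?; subst => //; rewrite Ca in Cb'.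
by subst; rewrite Ca' in Cb.
Qed.

(** The symmetric difference of A and B has 2 (2k - x) elements and its
complement has 2 x, where x is the size of the intersection; the squared
distance is the size of the cut that it defines. *)
Lemma edist_Kset (R : realType) (k : nat) (A B : {set Vset k}) :
  A \in Hset k -> B \in Hset k ->
  edist (indicator R (Sset A)) (indicator R (Sset B))
    = Num.sqrt (4 * #|A :&: B| * (2 * k - #|A :&: B|))%:R.
Proof.
rewrite !inE => /eqP cA /eqP cB; rewrite edist_indicator Sset_symdiff card_Sset.
congr (Num.sqrt _%:R); set D := _ :|: _.
have cD : #|D| = (2 * (2 * k - #|A :&: B|))%N.
  rewrite finset.cardsU (_ : _ :&: _ = finset.set0); last first.
    by apply/setP => x; rewrite !inE; case: (x \in A); case: (x \in B).
  by rewrite cards0 !cardsD cA cB (finset.setIC B A); lia.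
have := cardsC D; rewrite cD card_ord.
have : (#|A :&: B| <= 2 * k)%N by rewrite -cA subset_leq_card ?finset.subsetIl.
by nia.
Qed.

Lemma edist_Kset_le (R : realType) (k : nat) (x y : euclid R (Wset k)) :
  Kset R k x -> Kset R k y -> edist x y <= (2 * k)%:R.
Proof.
move=> [A HA ->] [B HB ->]; rewrite edist_Kset //.
rewrite -[leRHS]ger0_norm // -sqrtr_sqr ler_sqrt ?sqr_ge0 //.
rewrite -natrX ler_nat.
have : (#|A :&: B| <= 2 * k)%N.
  by move: HA; rewrite inE => /eqP <-; rewrite subset_leq_card ?finset.subsetIl.
move: #|_| => m mk; rewrite -[X in (_ <= X ^ 2)%N](subnKC mk).
by move: (2 * k - m)%N => l; rewrite -mulnA; exact: (nat_AGM2 m l).1.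
Qed.

Lemma edist_Kset_max (R : realType) (k : nat) (A B : {set Vset k}) :
  A \in Hset k -> B \in Hset k -> #|A :&: B| = k ->
  edist (indicator R (Sset A)) (indicator R (Sset B)) = (2 * k)%:R.
Proof.
move=> HA HB ABk; rewrite edist_Kset // ABk.
rewrite (_ : (_ * _)%N = (2 * k) ^ 2)%N; last by nia.
by rewrite natrX sqrtr_sqr ger0_norm.
Qed.

Lemma sum_indicator_Sset (R : realType) (k : nat) (A : {set Vset k}) :
  A \in Hset k -> \sum_e indicator R (Sset A) e = ((2 * k) ^ 2)%:R.
Proof.
rewrite inE => /eqP cA.
have := cardsC A; rewrite cA card_ord => cAC.
rewrite -mulnn; have {2}-> : (2 * k = #|~: A|)%N by lia.
rewrite -{1}cA -card_Sset -sum1_card natr_sum [RHS]big_mkcond /=.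
by apply: eq_bigr => e _; rewrite ffunE; case: (e \in _).
Qed.

(** * A hyperplane section of R^I embeds in dimension one less *)

Lemma sum_nth_pad (R : realType) (I : Type) (s : seq I) (n : nat) (u : I -> R) :
  (size s <= n)%N ->
  \sum_(j < n) (nth 0 (map u s) j) ^+ 2 = \sum_(i <- s) u i ^+ 2.
Proof.
move=> sn; rewrite -(big_mkord xpredT (fun j => nth 0 (map u s) j ^+ 2)).
rewrite (big_cat_nat (n := size s)) //= [X in _ + X]big_nat [X in _ + X]big1 ?addr0.
  by rewrite -(big_map u xpredT (fun y => y ^+ 2)) [RHS](big_nth 0) size_map.
by move=> j /andP[sj _]; rewrite nth_default ?size_map // expr0n.
Qed.

(** On vectors z of sum 0, drop the coordinate z_0 and add alpha z_0 to each of
the N others. The squared norm becomes the sum of the z_i^2 over i != 0 plus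
(N alpha^2 - 2 alpha) z_0^2, so the map is isometric when
N alpha^2 - 2 alpha = 1; a root is alpha = -1 / (1 + sqrt (N + 1)), which also
makes sense when N = 0. Missing coordinates are filled with 0. *)
Lemma hyperplane_isometric (R : realType) (I : finType) (n : nat) (c : R)
    (X : set (euclid R I)) :
  (0 < #|I| <= n.+1)%N -> (forall x, X x -> \sum_i x i = c) ->
  exists Y : set (euclid R 'I_n), isometric X Y.
Proof.
case/andP=> /card_gt0P[i0 _] In Xc.
pose s := Num.sqrt (#|I|%:R : R).
pose alpha : R := - (1 + s)^-1.
pose I' := enum (predC1 i0).
have cI : #|I| = (size I').+1.
  by rewrite /I' -cardE cardC1 prednK //; apply/card_gt0P; exists i0.
pose f (x : euclid R I) : euclid R 'I_n :=
  [ffun j : 'I_n => nth 0 [seq x i + alpha * x i0 | i <- I'] j].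
exists (f @` X)%classic, f; split=> // x y Xx Xy; congr Num.sqrt.
pose z i := x i - y i.
have z_sum : \sum_(i | i != i0) z i = - z i0.
  have : \sum_i z i = 0 by rewrite big_split /= sumrN !Xc // subrr.
  by rewrite (bigD1 i0) //= addrC => /eqP; rewrite addr_eq0 => /eqP.
have alphaE : (size I')%:R * alpha ^+ 2 + 2 * - alpha = 1.
  have s_ge0 : 0 <= s by rewrite sqrtr_ge0.
  have sE : (size I')%:R = s ^+ 2 - 1 :> R.
    by rewrite sqr_sqrtr // cI -addn1 natrD addrK.
  by rewrite sE /alpha; field; rewrite lt0r_neq0 // ltr_pwDl.
transitivity (\sum_(i <- I') (z i + alpha * z i0) ^+ 2).
  rewrite -[RHS](sum_nth_pad (n := n)); last by rewrite -ltnS -cI.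
  apply: eq_bigr => j _; rewrite !ffunE; congr (_ ^+ 2).
  have [jI|Ij] := ltnP j (size I'); last by rewrite !nth_default ?size_map // subrr.
  by rewrite !(nth_map i0) // /z; ring.
rewrite /I' big_enum /= [RHS](bigD1 i0) //=.
set w := alpha * z i0.
transitivity (\sum_(i | i != i0) (z i ^+ 2 + (2 * w) * z i + w ^+ 2)).
  by apply: eq_bigr => i _; ring.
rewrite !big_split /= -mulr_sumr z_sum -addrA addrC; congr (_ + _).
rewrite sumr_const (_ : #|_| = size I'); last by rewrite /I' -cardE.
by rewrite -mulr_natl -[RHS]mul1r -[X in _ = X * _]alphaE /w /z; ring.
Qed.

(** * Lower bound on the number of parts *)

Lemma ediam_ge_max (R : realType) (I : finType) (X P : set (euclid R I))
    (x y : euclid R I) (d : R) :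
  (P `<=` X)%classic -> (forall u v, X u -> X v -> edist u v <= d) ->
  P x -> P y -> edist x y = d -> ediam X <= ediam P.
Proof.
move=> PX X_le Px Py xyd; apply: (@le_trans _ _ d).
  apply: ge_sup; first by exists (edist x y), x, y; split=> //; apply: PX.
  by move=> _ [u [v [Xu Xv ->]]]; apply: X_le.
apply: ub_le_sup; last by exists x, y.
by exists d => _ [u [v [Pu Pv ->]]]; apply: X_le; apply: PX.
Qed.

(** As A and its complement have the same cut, the sets through v represent
each point of K once. *)
Definition Gset (k : nat) (v : Vset k) : {set {set Vset k}} :=
  [set A in Hset k | v \in A].

Lemma card_Gset (k : nat) (v : Vset k) :
  (0 < k)%N -> #|Gset v| = 'C((4 * k).-1, (2 * k).-1).
Proof.
move=> k_gt0.
have -> : Gset v = [set v |: D | D in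
    [set D : {set Vset k} | D \subset ~: [set v] & #|D| == (2 * k).-1]].
  apply/setP => A; rewrite !inE; apply/andP/imsetP => [[/eqP cA vA]|[D]].
    exists (A :\ v); last by rewrite finset.setD1K.
    rewrite inE finset.setDE finset.subsetIr -finset.setDE /=.
    by move: cA; rewrite (cardsD1 v) vA => <-.
  rewrite inE finset.subsetC finset.sub1set inE => /andP[vD /eqP cD] ->.
  rewrite cardsU1 vD cD finset.setU11 ; split=> //; apply/eqP; lia.
rewrite card_in_imset ?cards_draws ?cardsC1 ?card_ord //.
move=> D E; rewrite !inE finset.subsetC finset.sub1set inE => /andP[vD _].
rewrite finset.subsetC finset.sub1set inE => /andP[vE _] DE.
by rewrite -(finset.setU1K vD) DE finset.setU1K.
Qed.

Lemma card_Gset_avoiding (k : nat) (v : Vset k) (F : {set {set Vset k}}) :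
  prime k -> F \subset Gset v ->
  (forall A B, A \in F -> B \in F -> #|A :&: B| != k) ->
  (#|F| <= 'C((4 * k).-1, k.-1))%N.
Proof.
move=> k_pr /fintype.subsetP FG F_avoid; rewrite -[(4 * k)%N]card_ord.
apply: (card_avoiding_family (v := v)) => // A /FG.
by rewrite !inE => /andP[/eqP].
Qed.

(** The sets through v whose points lie in a given part form a family with no
two members meeting in k points, since such a pair would realize the diameter
of K. *)
Theorem divisible_Kset (R : realType) (k q : nat) :
  prime k -> divisible q (Kset R k) ->
  ('C((4 * k).-1, (2 * k).-1) <= q * 'C((4 * k).-1, k.-1))%N.
Proof.
move=> k_pr [P [KE diamP]]; have k_gt0 := prime_gt0 k_pr.
have k4_gt0 : (0 < 4 * k)%N by rewrite muln_gt0.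
pose v : Vset k := Ordinal k4_gt0.
pose F j := [set A in Gset v | `[< P j (indicator R (Sset A)) >]].
have GF : Gset v \subset \bigcup_j F j.
  apply/fintype.subsetP => A GA.
  have HA : A \in Hset k by move: GA; rewrite inE => /andP[].
  have : Kset R k (indicator R (Sset A)) by exists A.
  rewrite KE => -[j _ PjA]; apply/bigcupP; exists j => //.
  by rewrite inE GA; apply/asboolP.
rewrite -(card_Gset v) //; apply: (leq_trans (subset_leq_card GF)).
rewrite -[q in leqRHS]card_ord -sum_nat_const.
apply: (@leq_trans (\sum_j #|F j|)%N).
  elim/big_rec2: _ => [|j m S _ le_S]; first by rewrite cards0.
  by apply: leq_trans (leq_card_setU _ _) _; rewrite leq_add2l.
apply: leq_sum => j _; apply: (card_Gset_avoiding (v := v)) => //.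
  by apply/fintype.subsetP => A; rewrite inE => /andP[].
move=> A B; rewrite !inE => /andP[/andP[HA _] /asboolP PA].
move=> /andP[/andP[HB _] /asboolP PB]; apply/eqP => ABk.
have := diamP j; rewrite ltNge => /negP; apply.
apply: (ediam_ge_max (d := (2 * k)%:R)) PA PB _.
- by rewrite KE => x Px; exists j.
- exact: edist_Kset_le.
- by apply: edist_Kset_max; rewrite // inE.
Qed.

(** All the sets through v together exceed the bound on avoiding families, so
two of them meet in k points, and their points are at distance 2k. *)
Lemma Kset_two_points (R : realType) (k : nat) :
  prime k -> ('C((4 * k).-1, k.-1) < 'C((4 * k).-1, (2 * k).-1))%N ->
  exists x y, [/\ Kset R k x, Kset R k y & x <> y].
Proof.
move=> k_pr lt_bin; have k_gt0 := prime_gt0 k_pr.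
have k4_gt0 : (0 < 4 * k)%N by rewrite muln_gt0.
pose v : Vset k := Ordinal k4_gt0.
have [[A B]] : exists q : {set Vset k} * {set Vset k},
    [&& q.1 \in Gset v, q.2 \in Gset v & #|q.1 :&: q.2| == k].
  apply/existsP; apply: contraLR lt_bin => /existsPn none.
  rewrite -leqNgt -(card_Gset v) //; apply: card_Gset_avoiding => // A B GA GB.
  by have := none (A, B); rewrite /= GA GB.
rewrite /= !inE => /and3P[/andP[HA _] /andP[HB _] /eqP ABk].
exists (indicator R (Sset A)), (indicator R (Sset B)); split.
- by exists A; rewrite ?inE.
- by exists B; rewrite ?inE.
move=> AB; have := @edist_Kset_max R k A B; rewrite !inE => /(_ HA HB ABk).
rewrite AB /edist big1 => [|i _]; last by rewrite subrr expr0n.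
by rewrite sqrtr0 => /eqP; rewrite eq_sym pnatr_eq0 muln_eq0 /= (gtn_eqF k_gt0).
Qed.

Lemma card_Wset (k : nat) : #|Wset k| = 'C(4 * k, 2).
Proof.
by rewrite card_sig -[in RHS](card_ord (4 * k)) -card_draws cardsE; exact: eq_card.
Qed.

(** From C(51, 12) to C(51, 25) by the recurrence
(m+1) C(n, m+1) = (n-m) C(n, m), so that linear arithmetic in binary suffices;
the binomial coefficients are generalized because unary evaluation would not
terminate in practice. *)
Lemma bin_51 : (1561 * 'C(51, 12) < 'C(51, 25))%N.
Proof.
have c0 : (0 < 'C(51, 12))%N by rewrite bin_gt0.
have := (mul_bin_left 51 12, (mul_bin_left 51 13, (mul_bin_left 51 14,
  (mul_bin_left 51 15, (mul_bin_left 51 16, (mul_bin_left 51 17,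
  (mul_bin_left 51 18, (mul_bin_left 51 19, (mul_bin_left 51 20,
  (mul_bin_left 51 21, (mul_bin_left 51 22, (mul_bin_left 51 23,
  mul_bin_left 51 24)))))))))))).
move: c0.
move: 'C(51, 12) 'C(51, 13) 'C(51, 14) 'C(51, 15) 'C(51, 16) 'C(51, 17)
  'C(51, 18) 'C(51, 19) 'C(51, 20) 'C(51, 21) 'C(51, 22) 'C(51, 23) 'C(51, 24)
  'C(51, 25).
move=> c12 c13 c14 c15 c16 c17 c18 c19 c20 c21 c22 c23 c24 c25 c0.
move=> [h1 [h2 [h3 [h4 [h5 [h6 [h7 [h8 [h9 [h10 [h11 [h12 h13]]]]]]]]]]]].
lia.
Qed.

Theorem mainTheorem2 (R : realType) (n : nat) (hn : (1325 <= n <= 1560)%N) :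
  borsuk_counterexample n (Kset R 13).
Proof.
case/andP: hn => n_ge n_le.
(* Same inequality with the indices in the form of the general lemmas, so that
   no later step has to compare binomial coefficients by evaluating them. *)
have bin51 : (1561 * 'C((4 * 13).-1, 13.-1) < 'C((4 * 13).-1, (2 * 13).-1))%N.
  exact: bin_51.
split.
- by exists (2 * 13)%:R => x y; apply: edist_Kset_le.
- apply: Kset_two_points; first exact: isT.
  apply: leq_ltn_trans bin51.
  exact: leq_pmull.
- apply: (@hyperplane_isometric _ _ _ ((2 * 13) ^ 2)%:R); last first.
    by move=> x [A HA ->]; rewrite sum_indicator_Sset.
  have -> : #|Wset 13| = 1326%N by rewrite card_Wset bin2.
  exact: n_ge.
- move=> /(divisible_Kset (isT : prime 13)).
  apply/negP; rewrite -ltnNge; apply: leq_ltn_trans bin51.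
  by rewrite leq_mul2r ltnS n_le orbT.
Qed.
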